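(* Let $K$ be a field, $S=K[x_1,\ldots,x_n]$, let $G$ be a finite simple graph with vertex set $\{x_1,\ldots,x_n\}$ and edge ideal $I(G)\subset S$, and let $\mathfrak{c}=(c_1,\ldots,c_n)\in\mathbb{N}^n$ be a vector with $c_i>0$ for each $i=1,\ldots,n$. Then the following conditions are equivalent: (i) $(I(G)^s)_{\mathfrak{c}}$ has linear quotients for every $s=1,2,\ldots,\delta_{\mathfrak{c}}(I(G))$; (ii) the complementary graph $\overline{G}$ is chordal.
   Context: $\mathbb{N}$ is the set of nonnegative integers. The edge ideal of $G$ is $I(G)=(x_ix_j : x_ix_j\in E(G))\subset S$. For $\mathfrak{c}=(c_1,\ldots,c_n)\in\mathbb{N}^n$, a monomial $x_1^{a_1}\cdots x_n^{a_n}$ is $\mathfrak{c}$-bounded if $a_i\leq c_i$ for all $i$. For a monomial ideal $I\subset S$, $I_{\mathfrak{c}}$ denotes the ideal generated by all $\mathfrak{c}$-bounded monomials belonging to $I$. The number $\delta_{\mathfrak{c}}(I)$ is the largest integer $k$ such that $(I^k)_{\mathfrak{c}}\neq 0$ (with $I^0=S$). For a monomial ideal $I$, $\mathcal{G}(I)$ denotes its unique minimal set of monomial generators; $I$ has linear quotients if the elements of $\mathcal{G}(I)$ can be ordered as $u_1,\ldots,u_m$ so that for each $1\leq i<m$ the colon ideal $(u_1,\ldots,u_i):u_{i+1}$ is generated by a subset of $\{x_1,\ldots,x_n\}$. The complementary graph $\overline{G}$ has the same vertex set as $G$, and two distinct vertices are adjacent in $\overline{G}$ if and only if they are not adjacent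 in $G$. A graph is chordal if it has no cycle of length at least four as an induced subgraph. *)

(* Defs.v *)
From HB Require Import structures.
From mathcomp Require Import all_boot all_order all_algebra.
From mathcomp Require Export mpoly.
From Stdlib Require Import Classical ClassicalEpsilon.

Set Implicit Arguments.
Unset Strict Implicit.
Unset Printing Implicit Defensive.

Import GRing.Theory.
Local Open Scope ring_scope.

(* Subsets and ideals of a commutative ring are [Prop]-valued predicates;
   equality of ideals is pointwise equivalence. *)

Section Ideals.
Variable R : comNzRingType.
Implicit Types (A I J : R -> Prop) (f : R).

Inductive ideal_gen A : R -> Prop :=
  IdealGen (k : nat) (a b : 'I_k -> R) of (forall i, A (b i)) :
    ideal_gen A (\sum_(i < k) a i * b i).

Definition ideal_eq I J := forall f, I f <-> J f.

Definition ideal_mul I J : R -> Prop :=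
  ideal_gen (fun f => exists g h, [/\ I g, J h & f = g * h]).

Fixpoint ideal_exp I (k : nat) : R -> Prop :=
  if k is k'.+1 then ideal_mul I (ideal_exp I k') else fun=> True.

Definition ideal_colon I f : R -> Prop := fun g => I (g * f).

Definition ideal_nonzero I := exists f, I f /\ f != 0.

End Ideals.

Section MonomialIdeals.
Variables (K : fieldType) (n : nat).
Implicit Types (I : {mpoly K[n]} -> Prop) (c : 'X_{1..n}).
Implicit Types (u v : seq 'X_{1..n}).

(* Monomials are identified with their exponent vectors. *)
Definition mon_ideal (M : 'X_{1..n} -> Prop) : {mpoly K[n]} -> Prop :=
  ideal_gen (fun f => exists2 m, M m & f = 'X_[m]).

(* [u] enumerates, without repetition, a set of monomials that generates [I]
   and is minimal for inclusion among such sets. *)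
Definition min_mon_gens I u :=
  [/\ uniq u,
      ideal_eq I (mon_ideal (fun m => m \in u)) &
      forall v, {subset v <= u} -> ideal_eq I (mon_ideal (fun m => m \in v)) ->
        {subset u <= v}].

Definition var_ideal (A : {set 'I_n}) : {mpoly K[n]} -> Prop :=
  ideal_gen (fun f => exists2 j, j \in A & f = 'X_j).

(* With 0-based indexing, u_1, ..., u_i is [take i u] and u_{i+1} is the
   [i]-th item of [u]. *)
Definition linear_quotients I :=
  exists2 u, min_mon_gens I u &
    forall i, (1 <= i < size u)%N -> exists A : {set 'I_n},
      ideal_eq
        (ideal_colon (mon_ideal (fun m => m \in take i u)) 'X_[nth 0%MM u i])
        (var_ideal A).

Definition bounded_part c I : {mpoly K[n]} -> Prop :=
  mon_ideal (fun m => (m <= c)%MM /\ I 'X_[m]).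

Definition is_delta c I (k : nat) :=
  ideal_nonzero (bounded_part c (ideal_exp I k)) /\
  forall l, ideal_nonzero (bounded_part c (ideal_exp I l)) -> (l <= k)%N.

(* Unspecified when there is no largest such exponent (e.g. for the unit
   ideal); [edge_deltaP] below shows that this does not happen for edge
   ideals. *)
Definition delta c I : nat := epsilon (inhabits 0%N) (is_delta c I).

Definition edge_ideal (G : rel 'I_n) : {mpoly K[n]} -> Prop :=
  ideal_gen (fun f => exists i j, G i j /\ f = 'X_i * 'X_j).

End MonomialIdeals.

Arguments edge_ideal K {n} G.

Section Graphs.
Variable T : finType.
Implicit Types (G : rel T) (p : seq T).

Definition compl_graph G : rel T := [rel x y | (x != y) && ~~ G x y].

(* [ucycle G p] says that [p] lists distinct vertices and that cyclically
   consecutive ones are adjacent; the second clause says that the subgraph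
   induced on [p] has no other edges. *)
Definition induced_cycle G p :=
  ucycle G p /\
  {in p &, forall x y, G x y -> (y == next p x) || (x == next p y)}.

Definition chordal G :=
  forall p, (4 <= size p)%N -> ~ induced_cycle G p.

End Graphs.

Section EdgeDelta.
Variables (K : fieldType) (n : nat).
Implicit Types (I J : {mpoly K[n]} -> Prop) (c : 'X_{1..n}).

Let deg_ge (d : nat) (f : {mpoly K[n]}) :=
  forall m, m \in msupp f -> (d <= mdeg m)%N.

Lemma deg_geM d e f g : deg_ge d f -> deg_ge e g -> deg_ge (d + e) (f * g).
Proof.
move=> df eg m /msuppM_le /allpairsP[[m1 m2] /= [m1f m2g ->]].
by rewrite mdegD leq_add // ?df ?eg.
Qed.

Lemma deg_ge_gen d A f :
  (forall g, A g -> deg_ge d g) -> ideal_gen A f -> deg_ge d f.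
Proof.
move=> dA [k a b Ab] m /msupp_sum_le /flatten_mapP[i _].
by apply: (@deg_geM 0 d) => //; apply: dA.
Qed.

Lemma deg_ge_edge (G : rel 'I_n) k f :
  ideal_exp (edge_ideal K G) k f -> deg_ge k f.
Proof.
elim: k f => [|k IHk] f //=.
apply: deg_ge_gen => _ [g [h [Ig Ih ->]]].
apply: (@deg_geM 1 k); last exact: IHk.
apply: deg_ge_gen Ig => _ [i [j [_ ->]]].
by apply: (@deg_geM 1 0) => // m; rewrite msuppX inE => /eqP->; rewrite mdeg1.
Qed.

Lemma bounded_part_nonzeroP c I :
  ideal_nonzero (bounded_part c I) -> exists2 m, (m <= c)%MM & I 'X_[m].
Proof.
case=> _ [[[|k] a b Ab]]; first by rewrite big_ord0 eqxx.
by case: (Ab ord0) => m [mc Im] _ _; exists m.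
Qed.

Lemma edge_deltaP (G : rel 'I_n) c :
  is_delta c (edge_ideal K G) (delta c (edge_ideal K G)).
Proof.
apply: epsilon_spec.
pose P k := ideal_nonzero (bounded_part c (ideal_exp (edge_ideal K G) k)).
have P0 : P 0%N.
  exists 1; split; last exact: oner_neq0.
  rewrite -[X in bounded_part _ _ X](_ : \sum_(i < 1) 1 * 1 = 1).
    constructor=> _; exists 0%MM; last by rewrite mpolyX0.
    by split=> //; apply/mnm_lepP => i; rewrite mnm0E.
  by rewrite big_ord1 mulr1.
have Pub l : P l -> (l <= mdeg c)%N.
  case/bounded_part_nonzeroP=> m /mnm_lepP mc /deg_ge_edge lm.
  apply: (@leq_trans (mdeg m)); first by apply: lm; rewrite msuppX inE.
  by rewrite !mdegE leq_sum.
have PubS b : (forall l, P l -> (l <= b)%N) -> exists k, is_delta c (edge_ideal K G) k.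
  elim: b => [|b IHb] ub; first by exists 0%N.
  case: (classic (P b.+1)) => [Pb|nPb]; first by exists b.+1.
  apply: IHb => l Pl; have := ub l Pl; rewrite leq_eqVlt ltnS => /orP[/eqP El|//].
  by rewrite El in Pl.
exact: PubS Pub.
Qed.

End EdgeDelta.

(* Main.v *)
Require Import Defs.
From mathcomp Require Import all_boot all_order all_algebra.
From mathcomp Require Import zify.

(** A generator of [I(G)^s] is the degree sequence of a multiset of [s] edges.
    Linearly order the edges so that [I(G)] has linear quotients, compare edge
    multisets lexicographically (fewer late edges is better), and order the
    generators by their best representations [V].  If [U] is better than [V],
    let [e = pq] be the latest edge where they differ.  Delete [e] from [V]
    and follow alternating trails of [U \ V] and [V \ U] from [p] and from
    [q]: either a trail ends at a vertex whose degree in [U] exceeds that in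
    [V], and swapping along it improves [V], or both trails end by freeing a
    vertex.  In the latter case a remaining edge of [U] has two ends from each
    of which a trail gains such a vertex, and linear quotients of [I(G)] give
    an edge earlier than [e] that joins one of these ends to [p] or [q].  So
    all powers of [I(G)] have linear quotients.  The exchange only raises an
    exponent that was smaller in [V] than in [U], so it preserves
    [c]-boundedness.

    If the complement of [G] is chordal, a perfect elimination order of it
    (Dirac) makes [I(G)] have linear quotients.  Conversely, adding the edges
    of [G] in the order of a linear quotients ordering deletes edges of the
    complement one by one, starting from a complete graph; at each step the
    common neighbours of the two ends of the deleted edge form a clique, and
    such a deletion preserves chordality. *)

Set Implicit Arguments.
Unset Strict Implicit.
Unset Printing Implicit Defensive.

Import Order.TTheory GRing.Theory.

(** * Multisets of edges *)

Lemma lep0m n (m : 'X_{1..n}) : (0 <= m)%MM.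
Proof. by apply/mnm_lepP=> i; rewrite mnm0E. Qed.

Section EdgeMultisets.
Variables (n N : nat) (a b : 'I_N -> 'I_n).
Hypothesis ab_neq : forall i, a i != b i.
Implicit Types (U V W : 'X_{1..N}) (x y z : 'I_n) (i j e g : 'I_N).

Definition edge_mnm i : 'X_{1..n} := (U_(a i) + U_(b i))%MM.

(** Multisets of edges are exponent vectors over edge indices, so the monomial order compares them;
    [degseq V] is the exponent vector of the product of the edges in [V]. *)
Definition degseq V : 'X_{1..n} := (\sum_(i < N) edge_mnm i *+ V i)%MM.

Lemma degseqE V x : degseq V x = \sum_(i < N) edge_mnm i x * V i.
Proof. by rewrite mnm_sumE; apply: eq_bigr => i _; rewrite mulmnE. Qed.

Lemma degseqD V W : degseq (V + W) = (degseq V + degseq W)%MM.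
Proof.
apply/mnmP=> x; rewrite mnmDE !degseqE -big_split /=.
by apply: eq_bigr => i _; rewrite mnmDE mulnDr.
Qed.

Lemma degseq0 : degseq 0 = 0%MM.
Proof. by apply/mnmP=> x; rewrite degseqE mnm0E big1 // => i _; rewrite mnm0E muln0. Qed.

Lemma degseq1 i : degseq U_(i) = edge_mnm i.
Proof.
apply/mnmP=> x; rewrite degseqE (bigD1 i) //= big1 => [|j /negPf ji].
  by rewrite mnm1E eqxx muln1 addn0.
by rewrite mnm1E eq_sym ji muln0.
Qed.

Lemma degseqB V W : (W <= V)%MM -> degseq (V - W) = (degseq V - degseq W)%MM.
Proof. by move=> WV; rewrite -{2}(submK WV) degseqD addmK. Qed.

Lemma mdeg_degseq V : mdeg (degseq V) = 2 * mdeg V.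
Proof.
rewrite mdeg_sum mdegE big_distrr /=; apply: eq_bigr => i _.
by rewrite mdegMn mdegD !mdeg1.
Qed.

Lemma leq_degseq V W : (V <= W)%MM -> (degseq V <= degseq W)%MM.
Proof. by move=> VW; rewrite -(submK VW) degseqD lem_addl. Qed.

Lemma incident V x : 0 < degseq V x ->
  exists g y, [/\ (U_(g) <= V)%MM, x != y & edge_mnm g = (U_(x) + U_(y))%MM].
Proof.
rewrite degseqE lt0n => /eqP Vx; have [i] : exists i, edge_mnm i x * V i != 0.
  apply/existsP; apply: contra_notT Vx; rewrite negb_exists => /forallP Vx.
  by apply: big1 => i _; apply/eqP; rewrite -[_ == _]negbK Vx.
rewrite muln_eq0 negb_or -(lep1mP i) /edge_mnm mnmDE !mnm1E => /andP[xi iV].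
have [ax|ax] := eqVneq (a i) x.
  by exists i, (b i); rewrite -ax ab_neq.
have [bx|bx] := eqVneq (b i) x.
  by exists i, (a i); rewrite -bx eq_sym ab_neq /edge_mnm addmC.
by rewrite (negPf ax) (negPf bx) in xi.
Qed.

(* A maximal trail leaving [x], alternately along edges of [U] and of [V]. *)
Lemma alternating_trail U V x :
  exists U1 V1 z, [/\ (U1 <= U)%MM, (V1 <= V)%MM &
    (degseq U1 = degseq V1 + U_(x) + U_(z))%MM /\
       degseq V z + (z == x) < degseq U z \/
    (degseq U1 + U_(z) = degseq V1 + U_(x))%MM /\ degseq (U - U1) z = 0].
Proof.
elim: {U}(mdeg U).+1 {-2}U (ltnSn (mdeg U)) V x => // d IHd U Ud V x.
have [Ux|] := posnP (degseq U x).
  exists 0%MM, 0%MM, x; split; [exact: lep0m|exact: lep0m|right].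
  by rewrite subm0 degseq0 Ux.
case/incident=> g [y [gU xy gE]].
have [Dy|Dy] := ltnP (degseq V y) (degseq U y).
  exists U_(g)%MM, 0%MM, y; split=> //; first exact: lep0m.
  by left; rewrite degseq1 degseq0 add0m gE eq_sym (negPf xy) addn0.
(* Here [V] has at least the positive degree of [U] at [y], so the trail continues along an edge of
   [V]. *)
have [|h [y' [hV yy' hE]]] := @incident V y.
  apply: leq_trans Dy; apply: leq_trans (mnm_lepP (leq_degseq gU) y).
  by rewrite degseq1 gE mnmDE !mnm1E eqxx addn1.
have Ug : mdeg (U - U_(g)) < d.
  by have := congr1 (@mdeg _) (submK gU); rewrite mdegD mdeg1; lia.
have [U1 [V1 [z [U1U V1V C]]]] := IHd _ Ug (V - U_(h))%MM y'.
exists (U1 + U_(g))%MM, (V1 + U_(h))%MM, z; split.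
- by apply/mnm_lepP=> i; move: (mnm_lepP U1U i) (mnm_lepP gU i); rewrite mnmDE mnmBE; lia.
- by apply/mnm_lepP=> i; move: (mnm_lepP V1V i) (mnm_lepP hV i); rewrite mnmDE mnmBE; lia.
case: C => -[E Dz]; [left|right]; split.
- apply/mnmP=> w; move/mnmP/(_ w): E.
  by rewrite !degseqD !degseq1 gE hE !mnmDE; lia.
(* Deleting [g] and [h] costs both sides one unit at [y]; the unit lost by [V] at [y'] is offset by
   the term [z == y'], and the unit lost by [U] at [x] becomes the term [z == x]. *)
- move: Dz (mnm_lepP (leq_degseq gU) z) (mnm_lepP (leq_degseq hV) z).
  rewrite !degseqB // !mnmBE !degseq1 gE hE !mnmDE !mnm1E !(eq_sym z).
  by lia.
- apply/mnmP=> w; move/mnmP/(_ w): E.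
  by rewrite !degseqD !degseq1 gE hE !mnmDE; lia.
- suff -> : (U - (U1 + U_(g)) = U - U_(g) - U1)%MM by [].
  by rewrite submDA addmC.
Qed.

(* A surplus at [y] can be passed on along a trail to a vertex [z] at which [U]
   exceeds [V]; the trail may be trivial, with [z = y]. *)
Definition gainable U V y := exists U1 V1 z,
  [/\ (U1 <= U)%MM, (V1 <= V)%MM, (degseq U1 + U_(y) = degseq V1 + U_(z))%MM &
      degseq V z < degseq U z].

(** Take an edge [g] of [U] at a surplus vertex [x]. If its other end [y] has no surplus, some edge
    [h] of [V] leaves [y]; delete [g] and [h], recurse, and lift the trails. *)
Lemma gainable_edge U V : mdeg V < mdeg U ->
  exists g, [/\ (U_(g) <= U)%MM, gainable U V (a g) & gainable U V (b g)].
Proof.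
elim: {U}(mdeg U).+1 {-2}U (ltnSn (mdeg U)) V => // d IHd U Ud V VU.
have [x Dx] : exists x, degseq V x < degseq U x.
  apply/existsP; apply: contraLR VU; rewrite negb_exists -leqNgt => /forallP UV.
  rewrite -(leq_pmul2l (isT : 0 < 2)) -!mdeg_degseq !mdegE leq_sum // => x _.
  by rewrite leqNgt.
have gain0 y : degseq V y < degseq U y -> gainable U V y.
  by move=> Dy; exists 0%MM, 0%MM, y; split=> //; exact: lep0m.
have [|g [y [gU xy gE]]] := @incident U x; first by lia.
have [Dy|Dy] := ltnP (degseq V y) (degseq U y).
  exists g; split=> //; apply: gain0.
    move/mnmP/(_ (a g)): gE; rewrite !mnmDE !mnm1E eqxx.
    by case: (x =P a g) => [<-|_] //; case: (y =P a g) => [<-|_]; lia.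
  move/mnmP/(_ (b g)): gE; rewrite !mnmDE !mnm1E eqxx.
  by case: (x =P b g) => [<-|_] //; case: (y =P b g) => [<-|_]; lia.
have [|h [y' [hV yy' hE]]] := @incident V y.
  apply: leq_trans Dy; apply: leq_trans (mnm_lepP (leq_degseq gU) y).
  by rewrite degseq1 gE mnmDE !mnm1E eqxx addn1.
have [] := IHd (U - U_(g))%MM _ (V - U_(h))%MM.
- by have := congr1 (@mdeg _) (submK gU); rewrite mdegD mdeg1; lia.
- have := congr1 (@mdeg _) (submK gU); have := congr1 (@mdeg _) (submK hV).
  by rewrite !mdegD !mdeg1; lia.
move=> g' [g'U ga gb].
have gain w : gainable (U - U_(g)) (V - U_(h)) w -> gainable U V w.
  case=> U1 [V1 [z [U1U V1V E Dz]]].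
  have [Dz'|Dz'] := ltnP (degseq V z) (degseq U z).
    exists U1, V1, z; split=> //.
      exact: lepm_trans U1U (lem_subr _ _).
    exact: lepm_trans V1V (lem_subr _ _).
  (* Deleting [g] and [h] can create a surplus only at [y']. *)
  have zy' : z = y'.
    apply/eqP; apply: contraTT Dz => zy'.
    move: (mnm_lepP (leq_degseq gU) z) (mnm_lepP (leq_degseq hV) z).
    rewrite !degseqB // !mnmBE !degseq1 gE hE !mnmDE !mnm1E !(eq_sym _ z) (negPf zy').
    by lia.
  (* The trail that stopped at [y'] is prolonged through [h] and [g] to the surplus vertex [x]. *)
  exists (U1 + U_(g))%MM, (V1 + U_(h))%MM, x; split=> //.
  - by apply/mnm_lepP=> i; move: (mnm_lepP U1U i) (mnm_lepP gU i); rewrite mnmDE mnmBE; lia.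
  - by apply/mnm_lepP=> i; move: (mnm_lepP V1V i) (mnm_lepP hV i); rewrite mnmDE mnmBE; lia.
  apply/mnmP=> v; move/mnmP/(_ v): E.
  by rewrite !degseqD !degseq1 gE hE zy' !mnmDE; lia.
exists g'; split; [|exact: gain|exact: gain].
exact: lepm_trans g'U (lem_subr _ _).
Qed.
(* [I(G)] has linear quotients when its generators are listed by decreasing
   index: the order on ['X_{1..N}] compares the exponent of index 0 first, so
   lexicographically small multisets are those with few edges of low index. *)
Hypothesis link : forall e g, e < g -> exists (f : 'I_N) x y,
  [/\ e < f, x \in [:: a e; b e], y \in [:: a g; b g] &
      edge_mnm f = (U_(x) + U_(y))%MM].

Definition least_rep V :=
  forall W, mdeg W = mdeg V -> degseq W = degseq V -> ~~ (W < V)%O.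

(** This is the linear quotients condition for degree sequences: the monomial of [W] divides that of
    [V] times [x_l], and [l] is an index where [U] has the larger exponent. *)
Lemma exchange U V : mdeg U = mdeg V -> (U < V)%O -> least_rep V ->
  exists W l r, [/\ mdeg W = mdeg V, (W < V)%O,
    (degseq W + U_(r) = degseq V + U_(l))%MM & degseq V l < degseq U l].
Proof.
move=> UV /(ltmcP UV)[e UVlt UVe] Vleast.
(* At [e], the first index where they differ, [V] has more copies than [U]; the excess of [U] lies
   beyond [e]. *)
pose U' := (U - V)%MM; pose V' := (V - U)%MM; pose V0 := (V' - U_(e))%MM.
have U'gt i : 0 < U' i -> e < i.
  by rewrite mnmBE; case: (ltngtP i e) => [/UVlt ->|//|/val_inj ->]; lia.
have V'lt i : i < e -> V' i = 0 by move=> /UVlt; rewrite mnmBE; lia.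
have eV' : (U_(e) <= V')%MM by rewrite lep1mP mnmBE; lia.
have V0V' : V' = (V0 + U_(e))%MM by rewrite submK.
have V'V : (V' <= V)%MM by exact: lem_subr.
have degV' : degseq V' = (degseq V0 + U_(a e) + U_(b e))%MM.
  by rewrite V0V' degseqD degseq1 addmA.
have mdegU' : mdeg U' = mdeg V0 + 1.
  have : mdeg (V + U') = mdeg (U + V').
    by congr mdeg; apply/mnmP=> i; rewrite !mnmDE !mnmBE; lia.
  by rewrite !mdegD V0V' mdegD mdeg1; lia.
have D x : degseq V x + degseq U' x = degseq U x + degseq V' x.
  rewrite -!mnmDE -!degseqD; congr (degseq _ _).
  by apply/mnmP=> i; rewrite !mnmDE !mnmBE; lia.
have suppW (A : 'X_{1..N}) : (forall i, 0 < A i -> e < i) -> forall i, i <= e -> A i = 0.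
  by move=> sA i ie; apply/eqP; rewrite -leqn0 leqNgt; apply/negP=> /sA; lia.
have suppU A : (A <= U')%MM -> forall i, i <= e -> A i = 0.
  by move=> AU; apply: suppW => i Ai; apply: U'gt; apply: leq_trans Ai (mnm_lepP AU i).
(* Trading [B] and one copy of [e] for edges beyond [e] lowers [V]: the count of [e] drops and no
   earlier count changes. *)
have repl (A : 'X_{1..N}) B l r : (forall i, i <= e -> A i = 0) -> (B <= V0)%MM ->
    (degseq A + U_(r) = degseq B + U_(a e) + U_(b e) + U_(l))%MM ->
    exists W, [/\ mdeg W = mdeg V, (W < V)%O &
      (degseq W + U_(r) = degseq V + U_(l))%MM].
  move=> A0 BV0 E; pose C := (B + U_(e))%MM.
  have CV : (C <= V)%MM.
    apply: lepm_trans V'V; rewrite V0V'; apply/mnm_lepP=> i.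
    by rewrite !mnmDE leq_add2r (mnm_lepP BV0).
  have degW : (degseq (V - C + A) + U_(r) = degseq V + U_(l))%MM.
    apply/mnmP=> x; move/mnmP/(_ x): E; move/mnm_lepP/(_ x): (leq_degseq CV).
    rewrite degseqD degseqB // degseqD degseq1 /edge_mnm !mnmDE !mnmBE !mnmDE.
    by lia.
  have mW : mdeg (V - C + A) = mdeg V.
    by move/(congr1 (@mdeg _)): degW; rewrite mdegD [RHS]mdegD !mdeg_degseq !mdeg1; lia.
  exists (V - C + A)%MM; split=> //.
  apply/(ltmcP mW); exists e => [j je|].
    rewrite mnmDE mnmBE A0 1?ltnW // addn0.
    have := mnm_lepP BV0 j; rewrite /V0 mnmBE V'lt //= mnmDE mnm1E.
    by case: eqP => [ej|_]; [rewrite -ej ltnn in je|lia].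
  rewrite mnmDE mnmBE A0 // addn0 mnmDE mnm1E eqxx.
  by move: (mnm_lepP V'V e) (mnm_lepP eV' e); rewrite mnm1E eqxx; lia.
(* A trade with [l = r] would keep the degree sequence, against the minimality of [V]. *)
have no_loop (A : 'X_{1..N}) B : (forall i, i <= e -> A i = 0) -> (B <= V0)%MM ->
    (degseq A = degseq B + U_(a e) + U_(b e))%MM -> False.
  move=> A0 BV0 E; have [|W [mW WV]] := repl A B (a e) (a e) A0 BV0; first by rewrite E.
  by move/addIm => dW; move: (Vleast W mW dW); rewrite WV.
have [U1 [V1 [z1 [U1U V1V]]]] := alternating_trail U' V0 (b e).
case=> [[E1 Dz1]|[E1 Z1]].
  have z1a : z1 != a e.
    apply: contraPneq E1 => -> E1; apply: (no_loop U1 V1) => //; first exact: suppU.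
    by rewrite E1; apply/mnmP=> x; rewrite !mnmDE; clear; lia.
  have [||W [mW WV EW]] := repl U1 V1 z1 (a e) _ V1V; first exact: suppU.
    by rewrite E1; apply/mnmP=> x; rewrite !mnmDE; clear; lia.
  exists W, z1, (a e); split=> //.
  (* If the trail returns to its start [b e], the extra unit in [Dz1] makes up for the deleted edge
     [e]. *)
  have := D z1; rewrite degV' !mnmDE !mnm1E eq_sym (negPf z1a) eq_sym.
  by move: Dz1; clear; lia.
(* The second trail runs in what the first leaves, where no edge of [U2] meets [z1]. *)
pose U2 := (U' - U1)%MM; pose V2 := (V0 - V1)%MM.
have [U3 [V3 [z2 [U3U V3V]]]] := alternating_trail U2 V2 (a e).
have U3U' : (U3 <= U')%MM by apply: lepm_trans U3U (lem_subr _ _).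
have V3V' : (V3 <= V0)%MM by apply: lepm_trans V3V (lem_subr _ _).
have dU2 : (degseq U2 + degseq U1 = degseq U')%MM.
  by rewrite -degseqD /U2 submK.
have dV2 : (degseq V2 + degseq V1 = degseq V0)%MM.
  by rewrite -degseqD /V2 submK.
case=> [[E2 Dz2]|[E2 Z2]].
  have z2b : z2 != b e.
    apply: contraPneq E2 => -> E2; apply: (no_loop U3 V3) => //; first exact: suppU.
  have [||W [mW WV EW]] := repl U3 V3 z2 (b e) _ V3V'; first exact: suppU.
    by rewrite E2; apply/mnmP=> x; rewrite !mnmDE; clear; lia.
  exists W, z2, (b e); split=> //.
  have z21 : z2 != z1 by apply: contraTneq Dz2 => ->; rewrite Z1 ltn0.
  move: (D z2) (congr1 (fun m : 'X_{1..n} => m z2) E1).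
  move: (congr1 (fun m : 'X_{1..n} => m z2) dU2) (congr1 (fun m : 'X_{1..n} => m z2) dV2).
  rewrite degV' !mnmDE !mnm1E !(eq_sym _ z2) (negPf z2b) (negPf z21).
  by move: Dz2; clear; lia.
pose U4 := (U2 - U3)%MM; pose V4 := (V2 - V3)%MM.
have dU4 : (degseq U4 + degseq U3 = degseq U2)%MM.
  by rewrite -degseqD /U4 submK.
have dV4 : (degseq V4 + degseq V3 = degseq V2)%MM.
  by rewrite -degseqD /V4 submK.
(* Each trail used equally many edges on both sides, so [U4] has exactly one edge more than [V4]. *)
have [|g [gU ga gb]] := @gainable_edge U4 V4.
  move: (congr1 (@mdeg _) E1) (congr1 (@mdeg _) E2).
  move: (congr1 (@mdeg _) dU2) (congr1 (@mdeg _) dV2).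
  move: (congr1 (@mdeg _) dU4) (congr1 (@mdeg _) dV4).
  by rewrite !mdegD !mdeg_degseq !mdeg1 mdegU'; clear; lia.
have gainx y : y \in [:: a g; b g] -> gainable U4 V4 y.
  by rewrite !inE => /orP[]/eqP->.
have [|f [x [y [ef xe yg fE]]]] := @link e g.
  apply: U'gt; rewrite lt0n -lep1mP; apply: lepm_trans gU _.
  exact: lepm_trans (lem_subr _ _) (lem_subr _ _).
have [U5 [V5 [l [U5U V5V E3 Dl]]]] := gainx y yg.
have U5U2 : (U5 <= U2)%MM by apply: lepm_trans U5U (lem_subr _ _).
have U5U' : (U5 <= U')%MM by apply: lepm_trans U5U2 (lem_subr _ _).
have f0 i : i <= e -> (U_(f)%MM : 'X_{1..N}) i = 0.
  by rewrite mnm1E; case: eqP => // <-; rewrite leqNgt ef.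
have add0 (A B : 'X_{1..N}) i : A i = 0 -> B i = 0 -> (A + B)%MM i = 0 by rewrite mnmDE => -> ->.
(* No edge of [U4] meets [z1] or [z2]; at any other vertex the difference of degrees between [U] and
   [V] equals that between [U4] and [V4]. *)
have DUl : degseq V l < degseq U l.
  have l1 : l != z1.
    apply: contraTneq Dl => ->; move: (mnm_lepP (leq_degseq (lem_subr U2 U3)) z1).
    by rewrite -/U4 Z1 leqn0 => /eqP->.
  have l2 : l != z2 by apply: contraTneq Dl => ->; rewrite Z2 ltn0.
  move: (D l) (congr1 (fun m : 'X_{1..n} => m l) E1) (congr1 (fun m : 'X_{1..n} => m l) E2).
  move: (congr1 (fun m : 'X_{1..n} => m l) dU2) (congr1 (fun m : 'X_{1..n} => m l) dV2).
  move: (congr1 (fun m : 'X_{1..n} => m l) dU4) (congr1 (fun m : 'X_{1..n} => m l) dV4).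
  rewrite degV' !mnmDE !mnm1E !(eq_sym _ l) (negPf l1) (negPf l2).
  by move: Dl; clear; lia.
(* [f] covers one end of [e], the trail from the other end covers that end and frees [r], and the
   trail from [y] moves the surplus of [f] to [l]. *)
have [r [A [B [A0 BV E]]]] : exists r (A B : 'X_{1..N}), [/\ (forall i, i <= e -> A i = 0),
    (B <= V0)%MM & (degseq A + U_(r) = degseq B + U_(a e) + U_(b e) + U_(l))%MM].
  move: xe fE; rewrite !inE => /orP[]/eqP-> fE.
    exists z1, (U1 + U_(f) + U5)%MM, (V1 + V5)%MM; split.
    - by move=> i ie; rewrite !add0 ?f0 ?(suppU U1) ?(suppU U5).
    - apply/mnm_lepP=> i; move: (mnm_lepP V5V i) (mnm_lepP V1V i).
      by rewrite mnmDE !mnmBE; clear; lia.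
    apply/mnmP=> w; move/mnmP/(_ w): E1; move/mnmP/(_ w): E3.
    by rewrite !degseqD degseq1 fE !mnmDE; clear; lia.
  exists z2, (U3 + U_(f) + U5)%MM, (V3 + V5)%MM; split.
  - by move=> i ie; rewrite !add0 ?f0 ?(suppU U3) ?(suppU U5).
  - apply/mnm_lepP=> i; move: (mnm_lepP V5V i) (mnm_lepP V3V i).
    by rewrite mnmDE !mnmBE; clear; lia.
  apply/mnmP=> w; move/mnmP/(_ w): E2; move/mnmP/(_ w): E3.
  by rewrite !degseqD degseq1 fE !mnmDE; clear; lia.
have [W [mW WV EW]] := repl A B l r A0 BV E.
by exists W, l, r.
Qed.
End EdgeMultisets.

(** * Monomial ideals *)

Section Ideals.
Variable R : comNzRingType.
Implicit Types (A : R -> Prop) (f g : R).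
Local Open Scope ring_scope.

Lemma mem_ideal_gen A f : A f -> ideal_gen A f.
Proof.
move=> Af; rewrite (_ : f = \sum_(i < 1) 1 * f); first exact: IdealGen.
by rewrite big_ord1 mul1r.
Qed.

Lemma ideal_genMl A f g : ideal_gen A g -> ideal_gen A (f * g).
Proof.
case=> k u v Av; rewrite mulr_sumr.
under eq_bigr do rewrite mulrA.
exact: IdealGen.
Qed.
End Ideals.

Section MonomialIdeals.
Variables (K : fieldType) (n : nat).
Implicit Types (I : {mpoly K[n]} -> Prop) (M : 'X_{1..n} -> Prop).
Implicit Types (m c : 'X_{1..n}) (u : seq 'X_{1..n}) (f : {mpoly K[n]}).
Local Open Scope ring_scope.

Lemma mem_msuppMX f m m' :
  reflect (exists2 m0, m0 \in msupp f & m = (m0 + m')%MM) (m \in msupp (f * 'X_[m'])).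
Proof.
rewrite (perm_mem (msuppMX _ _)).
by apply: (iffP mapP) => -[m0 m0f ->]; exists m0; rewrite // addmC.
Qed.

Lemma mon_idealP M f :
  mon_ideal M f <->
  forall m, m \in msupp f -> exists2 m', M m' & (m' <= m)%MM.
Proof.
split=> [[k g h Mh] m /msupp_sum_le /flatten_mapP[i _]|fM].
  have [m' Mm' ->] := Mh i => /mem_msuppMX[m0 _ ->].
  by exists m' => //; exact: lem_addl.
pose s := msupp f; have fE : f = \sum_(i < size s) f@_(nth 0%MM s i) *: 'X_[nth 0%MM s i].
  by rewrite [LHS]mpolyE (big_nth 0%MM) big_mkord.
have /fin_all_exists2[t Mt st] (i : 'I_(size s)) :
    exists2 m', M m' & (m' <= nth 0%MM s i)%MM.
  exact/fM/mem_nth.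
rewrite fE; under eq_bigr => i _.
  rewrite -(submK (st i)) mpolyXD scalerAl; over.
by constructor=> i; exists (t i).
Qed.

Lemma mon_idealX M m : mon_ideal (K := K) M 'X_[m] <-> exists2 m', M m' & (m' <= m)%MM.
Proof.
rewrite mon_idealP; split=> [|Mm _ /mem_msuppXP <- //].
by apply; rewrite msuppX inE.
Qed.

Lemma mon_ideal_eq M M' :
  (forall m, M m -> exists2 m', M' m' & (m' <= m)%MM) ->
  (forall m, M' m -> exists2 m', M m' & (m' <= m)%MM) ->
  ideal_eq (mon_ideal (K := K) M) (mon_ideal M').
Proof.
move=> MM' M'M f; rewrite !mon_idealP; split=> fM m /fM[m1 Mm1 m1m].
  have [m2 M'm2 m21] := MM' m1 Mm1.
  by exists m2 => //; apply: lepm_trans m1m.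
have [m2 M'm2 m21] := M'M m1 Mm1.
by exists m2 => //; apply: lepm_trans m1m.
Qed.

Lemma var_idealP (A : {set 'I_n}) f :
  var_ideal A f <->
  forall m, m \in msupp f -> exists2 l, l \in A & (U_(l) <= m)%MM.
Proof.
have -> : var_ideal A f <-> mon_ideal (fun m => exists2 l, l \in A & m = U_(l)%MM) f.
  split=> -[k g h Ah]; constructor=> i; have [m] := Ah i.
    by move=> mA ->; exists U_(m)%MM => //; exists m.
  by case=> l lA -> ->; exists l.
rewrite mon_idealP; split=> fA m /fA.
  by case=> _ [l lA ->]; exists l.
by case=> l lA lm; exists U_(l)%MM => //; exists l.
Qed.

(** Otherwise [m] could be dropped from [u] without changing the ideal. *)
Lemma min_mon_gens_antichain I u m m' :
  min_mon_gens I u -> m \in u -> m' \in u -> (m' <= m)%MM -> m' = m.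
Proof.
case=> uu Iu umin mu m'u m'm; apply/eqP; apply: contraTT mu => m'Nm.
have sub_rem : {subset rem m u <= u} by move=> x /mem_rem.
suff /(umin _ sub_rem) : ideal_eq I (mon_ideal (fun x => x \in rem m u)).
  move=> usub; apply/negP=> /usub; rewrite mem_rem_uniq // inE eqxx.
  by [].
have E : ideal_eq (mon_ideal (K := K) (fun x => x \in u))
                  (mon_ideal (fun x => x \in rem m u)).
  apply: mon_ideal_eq => x xu; last by exists x; [exact: sub_rem|exact: lepm_refl].
  have [->|xm] := eqVneq x m.
    by exists m' => //; rewrite mem_rem_uniq // inE m'Nm.
  by exists x; [rewrite mem_rem_uniq // inE xm|exact: lepm_refl].
by move=> f; rewrite Iu.
Qed.

Lemma lepm_mdeg_eq m m' : (m <= m')%MM -> mdeg m = mdeg m' -> m = m'.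
Proof.
move=> mm' E; have := submK mm' => /[dup]/(congr1 (@mdeg _)).
rewrite mdegD E => /eqP; rewrite -{2}[mdeg m']add0n eqn_add2r mdeg_eq0.
by move/eqP=> ->; rewrite add0m.
Qed.

(** Generators of equal degree are automatically minimal. The colon ideal at [v] is generated by the
    variables [x_l] for which an earlier generator divides [v] times [x_l]. *)
Lemma linear_quotients_equigenerated I u d :
    uniq u -> ideal_eq I (mon_ideal (fun m => m \in u)) ->
    {in u, forall m, mdeg m = d} ->
    (forall i j, (j < i < size u)%N -> exists k l, [/\ (k < i)%N,
       (nth 0%MM u k <= nth 0%MM u i + U_(l))%MM &
       (nth 0%MM u i l < nth 0%MM u j l)%N]) ->
  linear_quotients I.
Proof.
move=> uu Iu ud lin; exists u.
  split=> // v vu Iv m mu; have : mon_ideal (K := K) (fun m => m \in v) 'X_[m].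
    by apply/Iv/Iu/mon_idealX; exists m => //; exact: lepm_refl.
  case/mon_idealX=> m' m'v m'm; rewrite -(lepm_mdeg_eq m'm) //.
  by rewrite !ud // vu.
move=> i /andP[_ iu]; set v := nth 0%MM u i.
exists [set l | has (fun m => m <= v + U_(l))%MM (take i u)] => f.
rewrite /ideal_colon mon_idealP var_idealP; split=> [fu m mf|fA _ /mem_msuppMX[m mf ->]].
  have [|w wi wm] := fu (m + v)%MM.
    by apply/mem_msuppMX; exists m.
  have [jiu Ew] : (index w (take i u) < i < size u)%N /\ nth 0%MM u (index w (take i u)) = w.
    have := wi; rewrite -index_mem size_take iu /= => ji; rewrite ji; split=> //.
    by rewrite -(nth_take _ ji) nth_index.
  have [k [l [ki kl vl]]] := lin i _ jiu; exists l.
    rewrite inE; apply/hasP; exists (nth 0%MM u k) => //.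
    by rewrite -(nth_take _ ki) mem_nth // size_take iu.
  rewrite lep1mP; move: vl (mnm_lepP wm l); rewrite Ew mnmDE -/v.
  by clear; lia.
have [l] := fA m mf; rewrite inE => /hasP[w wi wl] lm; exists w => //.
apply: lepm_trans wl _; apply/mnm_lepP=> x.
by rewrite !mnmDE addnC leq_add2r (mnm_lepP lm).
Qed.

Lemma linear_quotients_exchange I u i j :
  min_mon_gens I u ->
  (exists A : {set 'I_n},
      ideal_eq
        (ideal_colon (mon_ideal (K := K) (fun m => m \in take i u)) 'X_[nth 0%MM u i])
        (var_ideal A)) ->
  (j < i < size u)%N ->
  exists k l, [/\ (k < i)%N, (nth 0%MM u k <= nth 0%MM u i + U_(l))%MM &
    (nth 0%MM u i l < nth 0%MM u j l)%N].
Proof.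
move=> umin [A colA] /andP[ji iu]; set v := nth 0%MM u i; set w := nth 0%MM u j.
(* Subtraction is truncated, so [w - v] is the exponent of [w] divided by its gcd with [v]. *)
have : var_ideal A ('X_[w - v] : {mpoly K[n]}).
  apply/colA; rewrite /ideal_colon -mpolyXD; apply/mon_idealX; exists w.
    by rewrite /w -(nth_take _ ji) mem_nth // size_take iu.
  by apply/mnm_lepP=> x; rewrite mnmDE mnmBE addnC -leq_subLR.
move/var_idealP/(_ (w - v)%MM); rewrite msuppX inE eqxx => -[] // l lA lwv.
have : ideal_colon (mon_ideal (K := K) (fun m => m \in take i u)) 'X_[v] 'X_l.
  by apply/colA/var_idealP=> m /mem_msuppXP <-; exists l => //; exact: lepm_refl.
rewrite /ideal_colon -mpolyXD => /mon_idealX[m mi ml].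
have su : size (take i u) = i by rewrite size_take iu.
have ki : (index m (take i u) < i)%N by rewrite -{2}su index_mem.
exists (index m (take i u)), l; split=> //.
  by rewrite -(nth_take _ ki) nth_index // addmC.
by move: lwv; rewrite lep1mP mnmBE subn_eq0 -ltnNge.
Qed.
End MonomialIdeals.

(** * Bounded parts of powers of an edge ideal *)

Section EdgeIdealPowers.
Variables (K : fieldType) (n N : nat) (G : rel 'I_n) (a b : 'I_N -> 'I_n).
Hypothesis G_edge : forall i, G (a i) (b i).
Hypothesis edge_G : forall x y, G x y ->
  exists i, edge_mnm a b i = (U_(x) + U_(y))%MM.
Local Open Scope ring_scope.
Notation degseq := (degseq a b).

Lemma edge_ideal_exp_supp s (f : {mpoly K[n]}) m :
  ideal_exp (edge_ideal K G) s f -> m \in msupp f ->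
  exists2 V, mdeg V = s & (degseq V <= m)%MM.
Proof.
elim: s f m => [|s IHs] f m /=.
  by move=> _ _; exists 0%MM; rewrite ?mdeg0 // degseq0 lep0m.
case=> k g h gh /msupp_sum_le /flatten_mapP[i _] /msuppM_le /allpairsP[[m0 m1] /= [_ m1h ->]].
case: (gh i) m1h => f' [h' [fG hG ->]] /msuppM_le /allpairsP[[m2 m3] /= [m2f m3h ->]].
have [V Vs Vm3] := IHs _ _ hG m3h.
case: fG m2f => k' p q fG /msupp_sum_le /flatten_mapP[i' _].
have [x [y [/edge_G[e eE] ->]]] := fG i'; rewrite -mpolyXD => /mem_msuppMX[m4 _ ->].
exists (V + U_(e))%MM; first by rewrite mdegD mdeg1 Vs addn1.
rewrite degseqD degseq1 eE; apply/mnm_lepP=> w; move: (mnm_lepP Vm3 w).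
by rewrite !mnmDE; clear; lia.
Qed.

Lemma edge_ideal_exp_degseq V m : (degseq V <= m)%MM ->
  ideal_exp (edge_ideal K G) (mdeg V) 'X_[m].
Proof.
move Vs: (mdeg V) => s; elim: s V Vs m => [//|s IHs] V Vs m Vm /=.
have [e eV] : exists e, V e != 0%N.
  apply/existsP; apply: contra_eqT Vs; rewrite negb_exists => /forallP V0.
  by rewrite mdegE big1 // => i _; apply/eqP; rewrite -[_ == _]negbK V0.
have {}eV : (U_(e) <= V)%MM by rewrite lep1mP.
have mE : m = ((m - degseq V) + (edge_mnm a b e + degseq (V - U_(e))))%MM.
  by rewrite -degseq1 -degseqD (addmC U_(e)%MM) submK // submK.
rewrite mE mpolyXD; apply/ideal_genMl/mem_ideal_gen.
exists 'X_[edge_mnm a b e], 'X_[degseq (V - U_(e))]; split; last by rewrite mpolyXD.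
  by apply: mem_ideal_gen; exists (a e), (b e); rewrite G_edge mpolyXD.
apply: IHs; last exact: lepm_refl.
by have := congr1 (@mdeg _) (submK eV); rewrite mdegD mdeg1 Vs addn1 => -[].
Qed.

(** A bounded monomial of the power is divisible by a degree sequence, which is then bounded too. *)
Lemma bounded_part_edge_ideal_exp c s :
  ideal_eq (bounded_part c (ideal_exp (edge_ideal K G) s))
    (mon_ideal (fun m => (m <= c)%MM /\ exists2 V, mdeg V = s & m = degseq V)).
Proof.
apply: mon_ideal_eq => m [mc].
  move/edge_ideal_exp_supp => /(_ m); rewrite msuppX inE eqxx.
  case=> // V Vs Vm; exists (degseq V) => //; split; last by exists V.
  exact: lepm_trans Vm mc.
case=> V <- mE; exists m; last exact: lepm_refl.
by split=> //; apply: edge_ideal_exp_degseq; rewrite mE lepm_refl.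
Qed.

Hypothesis ab_neq : forall i, a i != b i.
Hypothesis link : forall e g : 'I_N, (e < g)%N -> exists (f : 'I_N) (x y : 'I_n),
  [/\ (e < f)%N, x \in [:: a e; b e], y \in [:: a g; b g] &
      edge_mnm a b f = (U_(x) + U_(y))%MM].

Lemma linear_quotients_bounded_powers c s :
  linear_quotients (bounded_part c (ideal_exp (edge_ideal K G) s)).
Proof.
pose reps := sort <=%O [seq val V | V in [pred V : 'X_{1..N < s.+1} | mdeg V == s]].
have mem_reps (V : 'X_{1..N}) : (V \in reps) = (mdeg V == s).
  rewrite mem_sort; apply/imageP/idP => [[W Ws ->]|Vs]; first by move: Ws; rewrite inE.
  have Vs' : (mdeg V < s.+1)%N by rewrite (eqP Vs).
  by exists (BMultinom Vs').
have reps_sorted : sorted <%O reps.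
  by rewrite sort_lt_sorted map_inj_uniq ?enum_uniq //; exact: val_inj.
pose least V := all (fun W => (degseq W == degseq V) ==> ~~ (W < V)%O) reps.
have leastP V : V \in reps -> least V -> least_rep a b V.
  move=> Vs /allP lV W WV degW; have := lV W; rewrite degW eqxx; apply.
  by rewrite mem_reps WV -mem_reps.
have to_least V : V \in reps -> exists W,
    [/\ W \in reps, least W, degseq W = degseq V & (W <= V)%O].
  elim/(well_founded_ind (@ltom_wf N)): V => V IHV Vs.
  have [lV|/allPn[W Ws]] := boolP (least V); first by exists V; rewrite lexx.
  rewrite negb_imply negbK => /andP[/eqP WV ltWV].
  have [X [Xs lX XW leXW]] := IHV W ltWV Ws.
  by exists X; rewrite XW WV (le_trans leXW) // ltW.
pose F := [seq V <- reps | least V && (degseq V <= c)%MM].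
have F_sorted : sorted <%O F by apply: sorted_filter => //; exact: lt_trans.
have memF V : V \in F -> [/\ mdeg V = s, least_rep a b V & (degseq V <= c)%MM].
  rewrite mem_filter => /andP[/andP[lV Vc] Vs]; split=> //; last exact: leastP.
  by apply/eqP; rewrite -mem_reps.
apply: (@linear_quotients_equigenerated K n _ (map degseq F) (2 * s)%N).
- rewrite map_inj_in_uniq ?lt_sorted_uniq // => V W VF WF E.
  have [[Vs lV _] [Ws lW _]] := (memF V VF, memF W WF).
  have := lV W; have := lW V; rewrite Vs Ws E => /(_ erefl erefl) + /(_ erefl erefl).
  by case: ltgtP.
- move=> f; rewrite bounded_part_edge_ideal_exp; apply: mon_ideal_eq => m.
    case=> mc [V Vs mE]; have [|W [Ws lW WV _]] := to_least V.
      by rewrite mem_reps Vs.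
    exists (degseq W); last by rewrite WV mE lepm_refl.
    by apply: map_f; rewrite mem_filter lW WV -mE mc.
  case/mapP=> V /memF[Vs _ Vc] ->; exists (degseq V); last exact: lepm_refl.
  by split=> //; exists V.
- by move=> _ /mapP[V /memF[<- _ _] ->]; rewrite mdeg_degseq.
rewrite size_map => i j /andP[ji iF]; have jF := ltn_trans ji iF.
rewrite !(nth_map 0%MM) //; set V := nth _ F i; set U := nth _ F j.
have [VF UF] : V \in F /\ U \in F by rewrite !mem_nth.
have [[Vs lV Vc] [Us _ Uc]] := (memF V VF, memF U UF).
have UV : (U < V)%O by rewrite /U /V lt_sorted_ltn_nth.
have [|W [l [r [WV ltWV degW Dl]]]] := exchange ab_neq link _ UV lV.
  by rewrite Us Vs.
(* [W] need not be the least representation of its monomial; passing to [X] only moves it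
   earlier. *)
have [|X [Xs lX XW leXW]] := to_least W; first by rewrite mem_reps WV Vs.
have WVl : (degseq W <= degseq V + U_(l))%MM by rewrite -degW lem_addr.
have XF : X \in F.
  rewrite mem_filter lX Xs andbT XW; apply/mnm_lepP=> x.
  apply: leq_trans (mnm_lepP WVl x) _; rewrite mnmDE mnm1E.
  have [<-|_] := eqVneq l x; last by rewrite addn0 (mnm_lepP Vc).
  by rewrite addn1; apply: leq_trans Dl (mnm_lepP Uc l).
have Xi : (index X F < i)%N.
  rewrite -(lt_sorted_ltn_nth 0%MM F_sorted) ?inE ?index_mem //.
  by rewrite nth_index // -/V (le_lt_trans leXW).
exists (index X F), l; split=> //.
by rewrite (nth_map 0%MM) ?index_mem // nth_index // XW.
Qed.
End EdgeIdealPowers.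

(** * Chordal graphs *)

Section Chordal.
Variable T : finType.
Implicit Types (E : rel T) (x y z v s t : T) (p q r : seq T) (W : {set T}).

Lemma next_nth_uniq x p y i : uniq (x :: p) -> i <= size p ->
  next (x :: p) (nth y (x :: p) i) = nth x p i.
Proof. by move=> up ip; rewrite next_nth mem_nth // index_uniq. Qed.

Lemma eq_chordal E E' : E =2 E' -> chordal E -> chordal E'.
Proof.
move=> EE' cE p p4 [/andP[cp up] ind]; apply: (cE p p4); split.
  by rewrite /ucycle /ucycleb (eq_cycle EE') cp.
by move=> x y xp yp; rewrite EE'; apply: ind.
Qed.

(* A shortest such [q] would close up, through [v], to an induced cycle. *)
Lemma chordal_detour E v s t q : symmetric E -> irreflexive E -> chordal E ->
  E v s -> E v t -> s != t -> path E s (rcons q t) ->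
  {in q, forall x, (x != v) && ~~ E v x} -> E s t.
Proof.
move=> Esym Eirr cE vs vt st; elim: {q}(size q).+1 {-2}q (ltnSn (size q)) => // d IHd q qd.
move=> sqt qNv; apply/idPn=> Nst; set w := rcons q t; set r := s :: w.
have size_w : size w = (size q).+1 by rewrite size_rcons.
have last_w : last s w = t by rewrite last_rcons.
have q0 : 0 < size q.
  by move: sqt Nst; rewrite lt0n; case: (q) => //= /andP[->].
have mem_w x : x \in w -> x = t \/ x \in q.
  by rewrite mem_rcons inE => /orP[/eqP|]; [left|right].
have step i : i < size w -> E (nth v r i) (nth v r i.+1).
  by move=> iw; move/(pathP v): sqt => /(_ i iw).
(* A chord would shortcut the path to one with a shorter interior [q']. *)
have no_chord i j : i.+1 < j -> j <= size w -> ~~ E (nth v r i) (nth v r j).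
  case: j => // j ij jw; apply/negP=> rij; pose q' := take i q ++ drop j q.
  have iw : i <= size q by lia.
  have jq : j <= size q by lia.
  have wE k : k <= size q -> path E s (take k q) /\ last s (take k q) = nth v r k.
    move=> kq; split; first by move: sqt; rewrite rcons_path => /andP[/(take_path k)].
    rewrite (last_nth v) size_takel // /r /w; case: k kq => //= k kq.
    by rewrite nth_take // nth_rcons kq.
  move/negP: Nst; apply; apply: (IHd q').
  - by rewrite size_cat size_takel // size_drop; lia.
  - have [pi li] := wE i iw; rewrite rcons_cat cat_path pi li -drop_rcons //.
    rewrite (drop_nth v jw) /= rij /=; move: sqt.
    rewrite -/w -{1}(cat_take_drop j w) cat_path => /andP[_].
    by rewrite (drop_nth v jw) => /andP[].
  - by move=> x; rewrite mem_cat => /orP[/mem_take|/mem_drop]; apply: qNv.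
have vr : v \notin r.
  rewrite inE; apply/norP; split; first by apply: contraTneq vs => <-; rewrite Eirr.
  apply/negP=> /mem_w[vt'|/qNv]; last by rewrite eqxx.
  by move: vt; rewrite -vt' Eirr.
have tq : t \notin q by apply/negP=> /qNv; rewrite vt andbF.
have sq : s \notin q by apply/negP=> /qNv; rewrite vs andbF.
(* If a vertex recurred, its first occurrence would be adjacent to the successor of its second: a
   chord. *)
have q_uniq i j : i < j -> j < size q -> nth v q i != nth v q j.
  move=> ij jq; have := @no_chord i.+1 j.+2; rewrite size_w !ltnS => /(_ ij jq).
  apply: contraNneq => qij; have := step j.+1; rewrite size_w ltnS => /(_ jq).
  by rewrite /r /= /w !nth_rcons jq (ltn_trans ij jq) qij.
have ur : uniq (v :: r).
  rewrite cons_uniq vr /= mem_rcons inE negb_or st sq rcons_uniq tq /=.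
  apply/(uniqP v) => i j; rewrite !inE => iq jq qij.
  by case: (ltngtP i j) => // ij; have := q_uniq _ _ ij; rewrite qij eqxx => /(_ ltac:(done)).
apply: (cE (v :: r)); first by rewrite /= size_w; lia.
split.
  by rewrite /ucycle /ucycleb ur andbT /= vs rcons_path sqt last_w Esym vt.
have adj i j : i < j -> j <= size r -> E (nth v (v :: r) i) (nth v (v :: r) j) ->
    (nth v (v :: r) j == next (v :: r) (nth v (v :: r) i)) ||
    (nth v (v :: r) i == next (v :: r) (nth v (v :: r) j)).
  move=> ij jr Eij; rewrite !next_nth_uniq ?(leq_trans (ltnW ij)) //.
  case: i ij Eij => [|i] ij Eij.
    case: j jr ij Eij => // j jr _ /=; case: j jr => [|j] jr; first by rewrite eqxx.
    move=> vj; have /mem_w[jt|/qNv] : nth v w j \in w by rewrite mem_nth.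
      apply/orP; right; rewrite /r /= -/r nth_default //.
      rewrite leqNgt; apply/negP=> jw.
      have jq : j < size q by move: jw; rewrite size_w.
      by move/negP: tq; apply; rewrite -jt /w nth_rcons jq mem_nth.
    by rewrite vj andbF.
  case: j ij jr Eij => // j ij jr Eij; apply/orP; left.
  have [->|ij'] := eqVneq j i.+1; first by [].
  by move: Eij; rewrite /= (negPf (no_chord _ _ _ _)) //; lia.
move=> x y /(nthP v)[i ir <-] /(nthP v)[j jr <-] Eij.
case: (ltngtP i j) => ij.
- exact: adj.
- by rewrite orbC; apply: adj => //; rewrite Esym.
- by move: Eij; rewrite ij Eirr.
Qed.

Lemma next_eq_head p x y : uniq (x :: p) -> y \in p ->
  next (x :: p) y = x -> y = last x p.
Proof.
move=> up /(nthP x)[i ip <-]; rewrite -[nth x p i]/(nth x (x :: p) i.+1).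
rewrite next_nth_uniq //= => nx; move: ip; rewrite leq_eqVlt => /orP[/eqP ip|ip].
  by rewrite -nth_last -ip.
by move: up; rewrite /= -nx mem_nth.
Qed.

Lemma next_last p x : uniq (x :: p) -> next (x :: p) (last x p) = x.
Proof. by move=> up; rewrite (last_nth x) next_nth_uniq // nth_default. Qed.

Definition simplicial E W z :=
  {in W &, forall x y, E z x -> E z y -> x != y -> E x y}.

(** * Simplicial vertices and perfect elimination orders *)

Section Dirac.
Variable E : rel T.
Hypotheses (Esym : symmetric E) (Eirr : irreflexive E) (cE : chordal E).

(* With [C] a component of the non-neighbours of [v] and [S] the neighbourhood
   of [C], [S] is a clique, so recursing on [C :|: S] finds a vertex in [C]. *)
Lemma simplicial_nonneighbor W v u : v \in W -> u \in W -> u != v -> ~~ E v u ->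
  exists z, [/\ z \in W, z != v, ~~ E v z & simplicial E W z].
Proof.
elim: {W}#|W|.+1 {-2}W (ltnSn #|W|) v u => // d IHd W Wd v u vW uW uv vu.
pose A := [set x in W | (x != v) && ~~ E v x].
have AP x : x \in A -> [/\ x \in W, x != v & ~~ E v x].
  by rewrite inE => /and3P[].
pose e := [rel x y | [&& x \in A, y \in A & E x y]].
have esym : symmetric e by move=> x y /=; rewrite Esym andbCA.
pose C := [set x | connect e u x].
have uC : u \in C by rewrite inE connect0.
have CA x : x \in C -> x \in A.
  rewrite inE => /connectP[p]; elim/last_ind: p => [_ ->|p y _].
    by rewrite inE uW uv.
  by rewrite rcons_path last_rcons /= => /and4P[_ _ yA _] ->.
pose S := [set x in W | E v x && [exists c in C, E c x]].
have SP x : x \in S -> [/\ x \in W, E v x & exists2 c, c \in C & E c x].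
  by rewrite inE => /and3P[xW vx /existsP[c /andP[cC cx]]]; split=> //; exists c.
pose W' := C :|: S.
have nbrC c x : c \in C -> x \in W -> E c x -> x \in W'.
  move=> cC xW cx; have [cW cv vc] := AP c (CA c cC).
  rewrite 2!inE; have [vx|vx] := boolP (E v x).
    apply/orP; right; rewrite inE xW vx; apply/existsP; exists c.
    by rewrite cC cx.
  apply/orP; left; move: (cC); rewrite inE => /connect_trans; apply.
  apply: connect1; rewrite /= CA // cx inE xW vx !andbT.
  by apply: contraNneq vc => <-; rewrite Esym.
have S_clique s t : s \in S -> t \in S -> s != t -> E s t.
  move=> /SP[sW vs [c cC cs]] /SP[tW vt [c' c'C c't]] st.
  have : connect e c c'.
    move: cC c'C; rewrite !inE => uc; apply: connect_trans.
    by rewrite (sym_connect_sym esym).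
  case/connectP=> p ep c'E; apply: (@chordal_detour E v s t (c :: p)) => //.
    rewrite /= Esym cs rcons_path -c'E c't andbT.
    by apply: sub_path ep => x y /and3P[].
  have : all (mem A) (c :: p).
    rewrite /= CA //=; elim: (p) (c) ep => //= y p' IHp x /andP[/and3P[_ yA _] /IHp].
    by move=> ->; rewrite yA.
  by move=> /allP pA x /pA /AP[_ -> ->].
have W'W : W' \subset W.
  apply/subsetP=> x; rewrite inE => /orP[/CA/AP[]//|/SP[]//].
have vW' : v \notin W'.
  rewrite inE negb_or; apply/andP; split; apply/negP.
    by move/CA/AP=> [_]; rewrite eqxx.
  by case/SP; rewrite Eirr.
have W'd : #|W'| < d.
  rewrite -ltnS; apply: leq_ltn_trans Wd; apply: proper_card.
  by apply/properP; split=> //; exists v.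
(* All neighbours in [W] of a vertex of [C] lie in [W'], so being simplicial in [W'] suffices. *)
suff [z zC simpz] : exists2 z, z \in C & simplicial E W' z.
  have [zW zv vz] := AP z (CA z zC); exists z; split=> // x y xW yW zx zy.
  by apply: simpz => //; apply: nbrC zC _ _.
have in_C z s : s \in S -> z \in W' -> z != s -> ~~ E s z -> z \in C.
  by move=> sS; rewrite inE => /orP[//|zS] zs; rewrite S_clique // eq_sym.
(* If some [s] in [S] has a non-neighbour in [W'], recursing from [s] gives a non-neighbour of [s],
   which lies in [C] because [S] is a clique. *)
have [/existsP[s /existsP[z]]|] :=
    boolP [exists s, exists z, [&& s \in S, z \in W', z != s & ~~ E s z]].
  case/and4P=> sS zW' zs sz; have sW' : s \in W' by rewrite inE sS orbT.
  have [x [xW' xs sx simpx]] := IHd W' W'd s z sW' zW' zs sz.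
  by exists x => //; apply: in_C xs sx.
move=> univ; have S_univ s z : s \in S -> z \in W' -> z != s -> E s z.
  move=> sS zW' zs; apply: contraNT univ => sz.
  by apply/existsP; exists s; apply/existsP; exists z; rewrite sS zW' zs.
(* Now [S] is joined to all of [W'], so recursing from a vertex of [C] cannot return a vertex of
   [S]; if [C] is a clique, so is [W']. *)
have [/existsP[c /existsP[z]]|clq] :=
    boolP [exists c, exists z, [&& c \in C, z \in C, z != c & ~~ E c z]].
  case/and4P=> cC zC zc cz.
  have [cW' zW'] : c \in W' /\ z \in W' by rewrite !in_setU cC zC.
  have [x [xW' xc cx simpx]] := IHd W' W'd c z cW' zW' zc cz.
  exists x => //; move: (xW'); rewrite inE => /orP[//|xS].
  by case/negP: cx; rewrite Esym S_univ // eq_sym.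
exists u => // x y xW' yW' _ _ xy.
have [xS|xS] := boolP (x \in S); first by rewrite S_univ // eq_sym.
have [yS|yS] := boolP (y \in S); first by rewrite Esym S_univ.
move: xW' yW'; rewrite !in_setU (negPf xS) (negPf yS) !orbF => xC yC.
apply: contraNT clq => Nxy; apply/existsP; exists x; apply/existsP; exists y.
by rewrite xC yC eq_sym xy.
Qed.

Lemma exists_simplicial W x : x \in W -> exists2 z, z \in W & simplicial E W z.
Proof.
move=> xW; have [/existsP[v /existsP[u]]|clq] :=
    boolP [exists v, exists u, [&& v \in W, u \in W, u != v & ~~ E v u]].
  by case/and4P=> vW uW uv vu; have [z []] := simplicial_nonneighbor vW uW uv vu; exists z.
exists x => // y z yW zW _ _ yz; apply: contraNT clq => Nyz.
by apply/existsP; exists y; apply/existsP; exists z; rewrite yW zW eq_sym yz.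
Qed.

(** A simplicial vertex is put first and the rest is ordered recursively. *)
Lemma perfect_elimination_order : exists rho : T -> nat, injective rho /\
  forall x y z, rho x < rho y -> rho x < rho z -> E x y -> E x z -> y != z -> E y z.
Proof.
suff H W : exists rho : T -> nat, {in W &, injective rho} /\
    {in W & &, forall x y z, rho x < rho y -> rho x < rho z ->
      E x y -> E x z -> y != z -> E y z}.
  have [rho [inj_rho peo]] := H [set: T]; exists rho; split=> [x y|x y z].
    exact: inj_rho.
  exact: peo.
elim: {W}#|W|.+1 {-2}W (ltnSn #|W|) => // d IHd W Wd.
have [->|[x xW]] := set_0Vmem W.
  by exists (fun=> 0); split=> ? ?; rewrite inE.
have [z zW simpz] := exists_simplicial xW.
have [|rho [inj_rho peo]] := IHd (W :\ z).
  by move: Wd; rewrite (cardsD1 z) zW.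
exists (fun x => if x == z then 0 else (rho x).+1); split.
  move=> x1 x2 x1W x2W /=; case: (eqVneq x1 z) => [->|x1z]; case: (eqVneq x2 z) => // x2z [].
  by apply: inj_rho; rewrite !inE ?x1z ?x2z.
move=> x1 x2 x3 x1W x2W x3W.
case: (eqVneq x2 z) => // x2z; case: (eqVneq x3 z) => // x3z.
have [-> _ _|x1z] := eqVneq x1 z; first exact: simpz.
by rewrite !ltnS; apply: peo; rewrite !inE ?x1z ?x2z ?x3z.
Qed.
End Dirac.

Lemma chordal_complete E : (forall x y, x != y -> E x y) -> chordal E.
Proof.
move=> Eall p p4 [/andP[_ up] ind].
case: p p4 up ind => [|x0 [|x1 [|x2 p]]] // p3 up ind.
have p0 : 0 < size p by [].
have x2x0 : x2 != x0.
  by apply: contraTneq up => ->; rewrite /= !inE eqxx orbT.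
have := ind x0 x2; rewrite !inE !eqxx !orbT => /(_ isT isT).
rewrite Eall 1?eq_sym // => /(_ isT).
have n0 : next [:: x0, x1, x2 & p] x0 = x1 by exact: (@next_nth_uniq x0 [:: x1, x2 & p] x0 0 up isT).
have n2 : next [:: x0, x1, x2 & p] x2 = nth x0 p 0.
  exact: (@next_nth_uniq x0 [:: x1, x2 & p] x0 2 up isT).
rewrite {}n0 {}n2; case: p p0 up {p3 ind} => // x3 p _ up /orP[]/eqP/= x23.
  by move: up; rewrite x23 /= !inE eqxx !andbF.
by move: up; rewrite x23 /= !inE eqxx !orbT.
Qed.

(** A new induced cycle passes through [a] and [b]. Let [s] and [t] be the neighbours of [a] on it;
    detours around [a] make both adjacent to [b], so the clique condition makes [st] a chord. *)
Lemma chordal_delete_edge E E' a b : symmetric E -> irreflexive E -> chordal E ->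
  E a b ->
  (forall x y, E' x y = E x y && ~~ ((x == a) && (y == b) || (x == b) && (y == a))) ->
  (forall x y, E a x -> E b x -> E a y -> E b y -> x != y -> E x y) ->
  chordal E'.
Proof.
move=> Esym Eirr cE ab E'E clq p p4 [/andP[cp up] ind].
have subE x y : E' x y -> E x y by rewrite E'E => /andP[].
have [/andP[ap bp]|] := boolP ((a \in p) && (b \in p)); last first.
  move=> Nab; apply: (cE p p4); split.
    by rewrite /ucycle /ucycleb up andbT; apply: sub_cycle cp.
  move=> x y xp yp xy; apply: ind => //; rewrite E'E xy /=.
  by apply: contra Nab => /orP[]/andP[/eqP<- /eqP<-]; rewrite xp yp.
have [k p' rotp] := rot_to ap.
have {}cp : cycle E' (a :: p') by rewrite -rotp rot_cycle.
have {}ind x y : x \in a :: p' -> y \in a :: p' -> E' x y ->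
    (y == next (a :: p') x) || (x == next (a :: p') y).
  by rewrite -rotp !mem_rot !next_rot //; apply: ind.
have {}bp : b \in a :: p' by rewrite -rotp mem_rot.
have size_p : size (a :: p') = size p by rewrite -rotp size_rot.
have {}up : uniq (a :: p') by rewrite -rotp rot_uniq.
have ba : b != a by apply: contraTneq ab => ->; rewrite Eirr.
have nab : ~~ E' a b by rewrite E'E !eqxx andbF.
have nba : ~~ E' b a by rewrite E'E !eqxx orbT andbF.
move: bp; rewrite inE (negPf ba) /= => bp.
case/splitPr: bp cp ind up size_p => [[|s q1] p2] cp ind up size_p.
  by case/andP: cp => /=; rewrite (negPf nab).
elim/last_ind: p2 cp ind up size_p => [|q2 t _] cp ind up size_p.
  by move: cp; rewrite /= rcons_cat cat_path /= (negPf nba) !andbF.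
have [path1 path2] : path E s (rcons q1 b) /\ path E b (rcons q2 t).
  move: cp; rewrite /= rcons_cat cat_path /= => /and4P[_ p1 p2 /= p3].
  move: p3; rewrite rcons_path => /andP[p3 _].
  by split; [rewrite rcons_path (sub_path subE p1) subE|exact: sub_path p3].
have [as' ta] : E a s /\ E a t.
  move: cp; rewrite /= rcons_cat cat_path /= => /and4P[/subE -> _ _].
  by rewrite rcons_path last_rcons Esym => /andP[_ /subE].
have lastt : last a ((s :: q1) ++ b :: rcons q2 t) = t.
  by rewrite last_cat /= last_rcons.
have up' : uniq [:: a, s, b, t & q1 ++ q2].
  rewrite -(perm_uniq (s1 := a :: (s :: q1) ++ b :: rcons q2 t)) //.
  by apply/permP=> P; rewrite /= !count_cat /= -cats1 count_cat /=; clear; lia.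
have [[sNa tNa] [sNb sNt] tNb] : [/\ s != a /\ t != a, s != b /\ s != t & t != b].
  move: up'; rewrite /= !inE !negb_or => /and5P[].
  by rewrite !(eq_sym _ a) !(eq_sym t) => /and4P[-> _ -> _] /and3P[-> -> _] /andP[->].
have tq1 : t \notin q1.
  by move: up'; rewrite /= mem_cat negb_or => /and5P[_ _ _ /andP[->]].
(* The cycle is induced, so [a] has no neighbours on it besides [s] and [t], apart from [b] through
   the deleted edge. *)
have E_a x : x \in q1 ++ q2 -> (x != a) && ~~ E a x.
  move=> xq; have xp : x \in (s :: q1) ++ b :: rcons q2 t.
    by move: xq; rewrite !(mem_cat, inE, mem_rcons) => /orP[]->; rewrite !orbT.
  have [xs xt xb xa] : [/\ x != s, x != t, x != b & x != a].
    by split; apply: contraTneq up' => <-; rewrite /= !inE xq ?orbT ?andbF.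
  rewrite xa; apply/negP=> ax; have := ind a x; rewrite mem_head inE xp orbT.
  rewrite E'E ax (negPf xb) (negPf xa) !andbF => /(_ isT isT isT).
  rewrite {1}/next /= eqxx (negPf xs) => /eqP nx.
  by move: xt; rewrite (next_eq_head up xp) ?lastt ?eqxx.
have Esb : E s b.
  apply: (@chordal_detour E a s b q1) => // x xq; apply: E_a.
  by rewrite mem_cat xq.
have Ebt : E b t.
  apply: (@chordal_detour E a b t q2) => // [|x xq]; first by rewrite eq_sym.
  by apply: E_a; rewrite mem_cat xq orbT.
have Est : E s t by apply: clq => //; rewrite Esym.
have := ind s t; rewrite !(inE, mem_cat, mem_rcons, eqxx, orbT) E'E Est.
rewrite (negPf sNa) (negPf sNb) => /(_ isT isT isT) /orP[|].
  rewrite -[s in next _ s]/(nth a (a :: (s :: q1) ++ b :: rcons q2 t) 1).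
  rewrite next_nth_uniq //=; case: (q1) tq1 => [|x q]; first by rewrite /= (negPf tNb).
  by rewrite /= inE negb_or => /andP[/negPf->].
by rewrite -{2}lastt next_last // (negPf sNa).
Qed.
End Chordal.

(** * Edge ideals *)

Lemma mnm1D_eq n (x y a b : 'I_n) : a != b ->
  ((U_(x) + U_(y))%MM == (U_(a) + U_(b))%MM) =
  (x == a) && (y == b) || (x == b) && (y == a).
Proof.
move=> ab; apply/eqP/orP => [|[]/andP[/eqP-> /eqP->] //]; last by rewrite addmC.
move/mnmP=> E; move: (E a) (E b); rewrite !mnmDE !mnm1E !eqxx eq_sym (negPf ab).
case: (eqVneq x a) => [->|xa].
  by rewrite (negPf ab) !add0n; case: (eqVneq y b) => //= _ _; left.
case: (eqVneq y a) => [->|ya] //=.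
by rewrite (negPf ab) addn0; case: (eqVneq x b) => // _ _ _; right.
Qed.

(** Edges start at their end of smaller [rho]; those whose start is eliminated earlier are listed
    later. *)
Lemma sorted_edges n (G : rel 'I_n) (rho : 'I_n -> nat) :
  exists N (a b : 'I_N -> 'I_n), [/\ forall i, G (a i) (b i) /\ rho (a i) < rho (b i),
    forall x y, G x y -> rho x < rho y -> exists i, a i = x /\ b i = y &
    forall i j : 'I_N, i <= j -> rho (a j) <= rho (a i)].
Proof.
pose s := sort (fun p q => rho q.1 <= rho p.1)
  [seq p <- enum {: 'I_n * 'I_n} | G p.1 p.2 && (rho p.1 < rho p.2)].
have mem_s p : (p \in s) = G p.1 p.2 && (rho p.1 < rho p.2).
  by rewrite mem_sort mem_filter mem_enum andbT.
exists (size s), (fun i => (tnth (in_tuple s) i).1), (fun i => (tnth (in_tuple s) i).2).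
split=> [i|x y Gxy xy|i j ij].
- by apply/andP; rewrite -mem_s mem_tnth.
- have /tnthP[i iE] : (x, y) \in in_tuple s by rewrite mem_s Gxy.
  by exists i; rewrite -iE.
pose p0 := tnth (in_tuple s) i; rewrite !(tnth_nth p0).
apply: (sorted_leq_nth (leT := fun p q => rho q.1 <= rho p.1)) => //; last 2 first.
- by rewrite inE.
- by rewrite inE.
- by move=> q p r /= pq qr; apply: leq_trans qr pq.
- by apply: sort_sorted => p q; apply: leq_total.
Qed.

Section EdgeIdeals.
Variables (K : fieldType) (n : nat) (G : rel 'I_n).
Hypotheses (Gsym : symmetric G) (Girr : irreflexive G).
Variable c : 'X_{1..n}.

Lemma chordal_linear_quotients s : chordal (compl_graph G) ->
  linear_quotients (bounded_part c (ideal_exp (edge_ideal K G) s)).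
Proof.
move=> cG; have compl_sym : symmetric (compl_graph G).
  by move=> x y; rewrite /compl_graph /= eq_sym Gsym.
have compl_irr : irreflexive (compl_graph G) by move=> x; rewrite /compl_graph /= eqxx.
have [rho [inj_rho peo]] := perfect_elimination_order compl_sym compl_irr cG.
(* Contrapositive of the elimination property of the complement. *)
have G_nbr x y z : rho x < rho y -> rho x < rho z -> G y z -> G x y \/ G x z.
  move=> xy xz Gyz; apply/orP; apply: contraTT Gyz.
  have [xNy xNz] : x != y /\ x != z.
    by split; apply/negP=> /eqP E; [rewrite E ltnn in xy|rewrite E ltnn in xz].
  rewrite negb_or => /andP[Nxy Nxz]; have [->|yz] := eqVneq y z; first by rewrite Girr.
  by have := peo x y z xy xz; rewrite /compl_graph /= xNy xNz Nxy Nxz yz => /(_ isT isT isT).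
have [N [a [b [ab_edge edge_ab a_sorted]]]] := sorted_edges G rho.
have edge_G x y : G x y -> exists i, edge_mnm a b i = (U_(x) + U_(y))%MM.
  move=> Gxy; case: (ltngtP (rho x) (rho y)) => [xy|yx|/inj_rho xy].
  - by have [i [<- <-]] := edge_ab x y Gxy xy; exists i.
  - have [|i [<- <-]] := edge_ab y x _ yx; first by rewrite Gsym.
    by exists i; rewrite addmC.
  - by rewrite xy Girr in Gxy.
apply: (@linear_quotients_bounded_powers K n N G a b) => //.
- by move=> i; have [] := ab_edge i.
- by move=> i; apply/negP=> /eqP abi; have [_] := ab_edge i; rewrite abi ltnn.
move=> e g eg; have [Ge abe] := ab_edge e; have [Gg abg] := ab_edge g.
(* If [e] and [g] start at the same vertex, [g] itself is the linking edge. Otherwise [a g] precedes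
   both ends of [e] in [rho] and is joined to one of them; that edge starts at [a g], hence is
   listed after [e]. *)
have := a_sorted e g (ltnW eg); rewrite leq_eqVlt => /orP[/eqP/inj_rho ageE|ag_ae].
  by exists g, (a e), (b g); rewrite !inE !eqxx orbT -ageE.
have [x xe Gax] : exists2 x, x \in [:: a e; b e] & G (a g) x.
  have [] := G_nbr (a g) (a e) (b e) ag_ae (ltn_trans ag_ae abe) Ge.
    by exists (a e); rewrite // !inE eqxx.
  by exists (b e); rewrite // !inE eqxx orbT.
have agx : rho (a g) < rho x.
  move: xe; rewrite !inE => /orP[]/eqP-> //; exact: ltn_trans abe.
have [f [af bf]] := edge_ab _ _ Gax agx.
exists f, x, (a g); split=> //; last by rewrite /edge_mnm af bf addmC.
  by rewrite ltnNge; apply/negP=> /a_sorted; rewrite af leqNgt ag_ae.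
by rewrite !inE eqxx.
Qed.

Hypothesis c_gt0 : forall i : 'I_n, 0 < c i.

(** Edge monomials are squarefree, hence bounded as all [c i] are positive. *)
Lemma bounded_part_edge_ideal :
  ideal_eq (bounded_part c (ideal_exp (edge_ideal K G) 1))
    (mon_ideal (fun m => exists x y, G x y /\ m = (U_(x) + U_(y))%MM)).
Proof.
have [N [a [b [ab_edge edge_ab _]]]] := sorted_edges G val.
have edge_G x y : G x y -> exists i, edge_mnm a b i = (U_(x) + U_(y))%MM.
  move=> Gxy; case: (ltngtP x y) => [xy|yx|/val_inj xy].
  - by have [i [<- <-]] := edge_ab x y Gxy xy; exists i.
  - have [|i [<- <-]] := edge_ab y x _ yx; first by rewrite Gsym.
    by exists i; rewrite addmC.
  - by rewrite xy Girr in Gxy.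
have G_edge i : G (a i) (b i) by have [] := ab_edge i.
move=> f; rewrite (bounded_part_edge_ideal_exp G_edge edge_G).
apply: mon_ideal_eq => m.
  case=> _ [V /eqP/mdeg1P[e /eqP->] ->]; rewrite degseq1.
  by exists (edge_mnm a b e); [exists (a e), (b e)|exact: lepm_refl].
case=> x [y [Gxy ->]]; exists (U_(x) + U_(y))%MM; last exact: lepm_refl.
have [e eE] := edge_G x y Gxy; split; last first.
  by exists U_(e)%MM; rewrite ?mdeg1 // degseq1.
apply/mnm_lepP=> z; rewrite mnmDE !mnm1E; apply: leq_trans (c_gt0 z).
by case: (eqVneq x z) => [xz|//]; case: (eqVneq y z) => // yz; rewrite xz yz Girr in Gxy.
Qed.

Lemma edge_generators u :
  min_mon_gens (bounded_part c (ideal_exp (edge_ideal K G) 1)) u ->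
  forall m, m \in u <-> exists x y, G x y /\ m = (U_(x) + U_(y))%MM.
Proof.
move=> umin; have [_ Iu _] := umin.
have u_edge m : m \in u ->
    exists x y, G x y /\ ((U_(x) + U_(y)) <= m)%MM.
  move=> mu; have /bounded_part_edge_ideal/mon_idealX[_ [x [y [Gxy ->]]] xym] :
      bounded_part c (ideal_exp (edge_ideal K G) 1) 'X_[m].
    by apply/Iu/mon_idealX; exists m => //; exact: lepm_refl.
  by exists x, y.
have edge_u x y : G x y -> (U_(x) + U_(y))%MM \in u.
  move=> Gxy; have /Iu/mon_idealX[m mu mxy] :
      bounded_part c (ideal_exp (edge_ideal K G) 1) 'X_[U_(x) + U_(y)].
    apply/bounded_part_edge_ideal/mon_idealX; exists (U_(x) + U_(y))%MM.
      by exists x, y.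
    exact: lepm_refl.
  have [x' [y' [_ xym]]] := u_edge m mu; suff <- : m = (U_(x) + U_(y))%MM by [].
  have xyE : (U_(x') + U_(y'))%MM = (U_(x) + U_(y))%MM.
    by apply: lepm_mdeg_eq (lepm_trans xym mxy) _; rewrite !mdegD !mdeg1.
  apply/mnmP=> z; apply/eqP; rewrite eqn_leq (mnm_lepP mxy).
  by rewrite -xyE (mnm_lepP xym).
move=> m; split=> [mu|[x [y [Gxy ->]]]]; last exact: edge_u.
have [x [y [Gxy xym]]] := u_edge m mu; exists x, y; split=> //.
by rewrite (min_mon_gens_antichain umin mu (edge_u x y Gxy) xym).
Qed.

Lemma linear_quotients_chordal :
  linear_quotients (bounded_part c (ideal_exp (edge_ideal K G) 1)) ->
  chordal (compl_graph G).
Proof.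
case=> u umin lin; have mem_u := edge_generators umin; have [uu _ _] := umin.
(* The complement of the graph whose edges are the first [k] generators. *)
pose compl_take k : rel 'I_n :=
  [rel x y | (x != y) && ((U_(x) + U_(y))%MM \notin take k u)].
suff H k : k <= size u -> chordal (compl_take k).
  apply: eq_chordal (H (size u) (leqnn _)) => x y; rewrite /compl_graph /compl_take /= take_size.
  congr (_ && ~~ _); apply/idP/idP => [/mem_u[x' [y' [Gxy /eqP]]]|Gxy].
    rewrite mnm1D_eq; last by apply: contraTneq Gxy => <-; rewrite Girr.
    by case/orP=> /andP[/eqP-> /eqP->]; rewrite // Gsym.
  by apply/mem_u; exists x, y.
elim: k => [_|k IHk ku].
  by apply: chordal_complete => x y xy; rewrite /compl_take /= xy take0.
have mu : nth 0%MM u k \in u by rewrite mem_nth.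
have /mem_u[a [b [Gab mE]]] := mu.
have ab : a != b by apply: contraTneq Gab => ->; rewrite Girr.
have take_k : take k.+1 u = rcons (take k u) (U_(a) + U_(b))%MM by rewrite (take_nth 0%MM) ?mE.
have abNk : (U_(a) + U_(b))%MM \notin take k u.
  by have := take_uniq k.+1 uu; rewrite take_k rcons_uniq => /andP[].
apply: (chordal_delete_edge (E := compl_take k) (a := a) (b := b)).
- by move=> x y; rewrite /compl_take /= eq_sym addmC.
- by move=> x; rewrite /compl_take /= eqxx.
- exact/IHk/ltnW.
- by rewrite /compl_take /= ab abNk.
- move=> x y; rewrite /compl_take /= take_k mem_rcons inE negb_or mnm1D_eq //.
  by rewrite andbCA andbC.
move=> x y; rewrite /compl_take /= => /andP[ax axN] /andP[bx bxN] /andP[ay ayN] /andP[by_ byN] xy.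
rewrite xy; apply/negP=> /[dup] xyk.
rewrite -index_mem size_take ku => jk.
have xyE : nth 0%MM u (index (U_(x) + U_(y))%MM (take k u)) = (U_(x) + U_(y))%MM.
  by rewrite -(nth_take _ jk) nth_index.
have k0 : 0 < k by apply: leq_ltn_trans jk.
(* If [xy] were among the first [k] generators, some earlier generator would divide [x_a x_b x_l]
   with [l] in [{x, y}]; it would be [ab], [al] or [bl], none of which is listed yet. *)
have [||i [l [ik il ]]] := linear_quotients_exchange umin (lin k _) (j := index (U_(x) + U_(y))%MM (take k u)).
- by rewrite k0 ku.
- by rewrite jk ku.
rewrite mE xyE => kl; rewrite mE in il.
have iu : nth 0%MM u i \in take k u.
  by rewrite -(nth_take 0%MM ik) mem_nth // size_take ku.
have /mem_u[a' [b' [Gab' iE]]] : nth 0%MM u i \in u by exact: mem_take iu.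
have ab' : a' != b' by apply: contraTneq Gab' => ->; rewrite Girr.
have lxy : (l == x) || (l == y).
  by move: kl; rewrite !mnmDE !mnm1E (eq_sym x) (eq_sym y); case: (l == x); case: (l == y); rewrite ?ltn0.
have abl z : z \in [:: a'; b'] -> z \in [:: a; b; l].
  have := mnm_lepP il z; rewrite iE !mnmDE !mnm1E !inE !(eq_sym z).
  by case: (a' == z); case: (b' == z); case: (a == z); case: (b == z); case: (l == z).
have Nk (s t : 'I_n) : (U_(s) + U_(t))%MM \notin take k u ->
    ~ (a' = s /\ b' = t \/ a' = t /\ b' = s).
  by move=> stN [[E1 E2]|[E1 E2]]; move: stN; rewrite -E1 -E2 -?iE ?iu // addmC -iE iu.
have [alN blN] : (U_(a) + U_(l))%MM \notin take k u /\ (U_(b) + U_(l))%MM \notin take k u.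
  by case/orP: lxy => /eqP->.
have := abl a' (mem_head _ _); have := abl b' (mem_last a' [:: b']).
move: (Nk _ _ abNk) (Nk _ _ alN) (Nk _ _ blN) ab'; rewrite !inE.
move=> N1 N2 N3 ab' /or3P[]/eqP E1 /or3P[]/eqP E2; move: N1 N2 N3 ab';
  by rewrite E1 E2 ?eqxx //; tauto.
Qed.
End EdgeIdeals.

Theorem theorem4p1 (K : fieldType) (n : nat) (G : rel 'I_n)
    (Gsym : symmetric G) (Girr : irreflexive G)
    (c : 'X_{1..n}) (c_gt0 : forall i : 'I_n, 0 < c i) :
  (forall s : nat, 1 <= s <= delta c (edge_ideal K G) ->
     linear_quotients (bounded_part c (ideal_exp (edge_ideal K G) s)))
  <-> chordal (compl_graph G).
Proof.
split=> [lin|cG s _]; last exact: chordal_linear_quotients.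
(* An edge makes [delta] at least 1, so [s = 1] is available; without edges the range of [s] gives
   nothing, but the complement is complete. *)
have [/existsP[x /existsP[y Gxy]]|noG] := boolP [exists x, exists y, G x y].
  apply: (@linear_quotients_chordal K n G Gsym Girr c c_gt0); apply: lin.
  rewrite leqnn; have [_ -> //] := edge_deltaP K G c.
  exists 'X_[U_(x) + U_(y)]; split; last by rewrite -msupp_eq0 msuppX.
  apply/(bounded_part_edge_ideal Gsym Girr c_gt0)/mon_idealX.
  by exists (U_(x) + U_(y))%MM; [exists x, y|exact: lepm_refl].
apply: chordal_complete => x y xy; rewrite /compl_graph /= xy; apply: contraNN noG => Gxy.
by apply/existsP; exists x; apply/existsP; exists y.
Qed.
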